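(* Let $n,d\ge 1$ be integers and $\alpha\in[0,1]$. Let $\widehat{C}_n$ be any algorithm that provides a $(1-\alpha)$-distribution-free confidence interval for binary regression. Then $\widehat{C}_n$ also satisfies $(1-\alpha)$ predictive coverage uniformly over all nonatomic distributions, that is, for every nonatomic distribution $P$ on $\mathbb{R}^d\times\{0,1\}$, if $(X_1,Y_1),\dots,(X_{n+1},Y_{n+1})$ are drawn i.i.d. from $P$, then \[\mathbb{P}\left\{Y_{n+1}\in\widehat{C}_n(X_{n+1})\right\}\ge 1-\alpha.\]
   Context: For a distribution $P$ on $(X,Y)\in\mathbb{R}^d\times\{0,1\}$, let $\pi_P(x)=\mathbb{P}_P\{Y=1\mid X=x\}$ be the conditional label probability. An algorithm $\widehat{C}_n$ takes the training data $(X_1,Y_1),\dots,(X_n,Y_n)\in\mathbb{R}^d\times\{0,1\}$ and produces a map sending each $x\in\mathbb{R}^d$ to a set $\widehat{C}_n(x)\subseteq\mathbb{R}$ (suitable measurability is implicit). The algorithm may be randomized: $\widehat{C}_n(x)$ may also depend on additional randomness independent of the data, and then all probabilities and expectations are also taken over this randomness. The set $\widehat{C}_n(X_{n+1})$ is computed from $(X_i,Y_i)_{i\le n}$ and $X_{n+1}$ (not $Y_{n+1}$). $\widehat{C}_n$ provides a $(1-\alpha)$-distribution-free confidence interval for binary regression if, for all distributions $P$ on $\mathbb{R}^d\times\{0,1\}$, with $(X_i,Y_i)$, $i=1,\dots,n+1$, drawn i.i.d. from $P$, \[\mathbb{P}\{\pi_P(X_{n+1})\in\widehat{C}_n(X_{n+1})\}\ge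 1-\alpha.\] $P$ is nonatomic if it assigns zero probability to every single point. *)

(* Defs.v *)
From mathcomp Require Import all_boot all_order all_algebra.
From mathcomp Require Import all_classical all_reals all_analysis.

Set Implicit Arguments.
Unset Strict Implicit.
Unset Printing Implicit Defensive.

Import Order.TTheory GRing.Theory Num.Theory.

Local Open Scope classical_set_scope.
Local Open Scope ring_scope.

(* R^d is [d.-tuple R], whose canonical (product) sigma-algebra is the Borel
   one; the label space {0,1} is [bool]. *)
Notation obs R d := (d.-tuple R * bool)%type.

Definition label (R : realType) (y : bool) : R := y%:R.

Section Probability.
Context {R : realType} {dO : measure_display} {Omega : measurableType dO}.
Variable Pr : probability Omega R.

Definition has_law {dT : measure_display} {T : measurableType dT}
    (X : {RV Pr >-> T}) (P : probability T R) : Prop :=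
  forall A : set T, measurable A -> distribution Pr X A = P A.

Definition mutually_independent {dT : measure_display} {T : measurableType dT}
    (m : nat) (X : 'I_m -> {RV Pr >-> T}) : Prop :=
  forall (J : {set 'I_m}) (A : 'I_m -> set T),
    (forall i, measurable (A i)) ->
    Pr (\bigcap_(i in [set` J]) X i @^-1` A i)
      = (\prod_(i in J) Pr (X i @^-1` A i))%E.

Definition independent {d1 d2 : measure_display}
    {T1 : measurableType d1} {T2 : measurableType d2}
    (X : Omega -> T1) (Y : Omega -> T2) : Prop :=
  forall (A : set T1) (B : set T2), measurable A -> measurable B ->
    Pr (X @^-1` A `&` Y @^-1` B) = (Pr (X @^-1` A) * Pr (Y @^-1` B))%E.

Definition iid {dT : measure_display} {T : measurableType dT}
    (P : probability T R) (m : nat) (X : 'I_m -> {RV Pr >-> T}) : Prop :=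
  (forall i, has_law (X i) P) /\ mutually_independent X.

End Probability.

(* [p] is a version of x |-> P(Y = 1 | X = x), which is determined by P only up
   to a null set of the law of X. *)
Definition is_label_prob (R : realType) (d : nat) (P : probability (obs R d) R)
    (p : d.-tuple R -> R) : Prop :=
  [/\ measurable_fun setT p,
      forall x, 0 <= p x <= 1
    & forall A : set (d.-tuple R), measurable A ->
        (\int[P]_(z in A `*` setT) (p z.1)%:E)%E = P (A `*` [set true])].

Definition nonatomic (R : realType) (d : nat) (P : probability (obs R d) R)
    : Prop :=
  forall z : obs R d, P [set z] = 0%E.

(* The additional randomness of the algorithm is a seed, drawn from a law that
   is part of the algorithm; a deterministic algorithm ignores it.  The
   measurability condition (joint, for the graph of the random set) makes
   {f(X_{n+1}) \in C_n(X_{n+1})} an event for every Borel f. *)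
Record algorithm (R : realType) (n d : nat) := Algorithm {
  seed_display : measure_display;
  seed : measurableType seed_display;
  seed_law : probability seed R;
  conf_set : n.-tuple (obs R d) -> seed -> d.-tuple R -> set R;
  measurable_conf_set : measurable
    [set q : n.-tuple (obs R d) * seed * d.-tuple R * R |
      q.2 \in conf_set q.1.1.1 q.1.1.2 q.1.2] }.

Arguments measurable_conf_set {R n d} C : rename.

Section Coverage.
Context {R : realType} {n d : nat} (C : algorithm R n d).
Context {dO : measure_display} {Omega : measurableType dO}.
Variable Pr : probability Omega R.
Variables (Z : 'I_n.+1 -> {RV Pr >-> obs R d}) (U : {RV Pr >-> seed C}).

(* [Z i], for i < n, are the training data and [Z ord_max] is the test point
   (X_{n+1}, Y_{n+1}). *)
Definition experiment (P : probability (obs R d) R) : Prop :=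
  [/\ iid P Z,
      has_law U (seed_law C)
    & independent Pr (fun w => [tuple Z i w | i < n.+1]) U].

Definition test_x (w : Omega) : d.-tuple R := (Z ord_max w).1.
Definition test_y (w : Omega) : bool := (Z ord_max w).2.

Definition random_conf_set (w : Omega) : set R :=
  conf_set [tuple Z (widen_ord (leqnSn n) i) w | i < n] (U w) (test_x w).

End Coverage.

Definition distribution_free_CI (R : realType) (n d : nat) (alpha : R)
    (C : algorithm R n d) : Prop :=
  forall (P : probability (obs R d) R) (p : d.-tuple R -> R),
    is_label_prob P p ->
  forall (dO : measure_display) (Omega : measurableType dO)
    (Pr : probability Omega R)
    (Z : 'I_n.+1 -> {RV Pr >-> obs R d}) (U : {RV Pr >-> seed C}),
    experiment Z U P ->
    ((1 - alpha)%:E <= Pr [set w | p (test_x Z w) \in random_conf_set Z U w])%E.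

Definition predictive_coverage (R : realType) (n d : nat) (alpha : R)
    (C : algorithm R n d) (P : probability (obs R d) R) : Prop :=
  forall (dO : measure_display) (Omega : measurableType dO)
    (Pr : probability Omega R)
    (Z : 'I_n.+1 -> {RV Pr >-> obs R d}) (U : {RV Pr >-> seed C}),
    experiment Z U P ->
    ((1 - alpha)%:E <=
      Pr [set w | label R (test_y Z w) \in random_conf_set Z U w])%E.

(* Main.v *)
Require Import Defs.
From HB Require Import structures.
From mathcomp Require Import all_boot all_order all_algebra.
From mathcomp Require Import all_classical all_reals all_analysis.
From mathcomp Require Import measurable_realfun.
Import Order.TTheory GRing.Theory Num.Theory.
Local Open Scope classical_set_scope.
Local Open Scope ring_scope.

(** Sampling with replacement from a large finite population is almost the same
    as sampling without replacement, and the two give the two kinds of coverage.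

    Draw a population L of M points from P.  As P is nonatomic, the points
    almost surely have distinct first components ([nonatomic_same_point],
    [iid_collision]).  Fix such an L and let Q be its empirical distribution.
    Under Q the label is a function of the point, so the label probability of Q
    is an indicator, and at a test point drawn from Q it is equal to the label
    itself ([is_label_prob_indic]).  A distribution-free confidence interval
    applied to Q therefore contains the label with probability at least
    1 - alpha ([resample_coverage]); this is where sampling from L is with
    replacement.

    Now average over L.  An iid sample from Q is the family of the L (I k),
    with iid uniform indices I k.  When the n + 1 indices are distinct, the
    L (I k) with L random are an iid sample from P ([iid_reindex]), so the label
    is covered with the same probability q as under P.  Two indices coincide
    with probability 1 / M, so they are not all distinct with probability at
    most (n + 1)^2 / M.  By Tonelli, 1 - alpha <= q + (n + 1)^2 / M
    ([predictive_coverage_approx]), and M is arbitrary.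

    The seed of the algorithm is integrated out from the start: the probability
    that the label is covered is the integral, over the law of the sample, of a
    measurable function of the n + 1 observations ([coverageE]). *)

Set Implicit Arguments.
Unset Strict Implicit.
Unset Printing Implicit Defensive.

(** * Independent samples *)

Definition rv {R : realType} {d1 d2} {T1 : measurableType d1}
    {T2 : measurableType d2} (Pr : probability T1 R) (f : T1 -> T2)
    (mf : measurable_fun setT f) : {RV Pr >-> T2} :=
  HB.pack f (isMeasurableFun.Build _ _ _ _ f mf).

Section IID.
Context {R : realType}.

(** Subfamilies are recovered from the whole family by taking the full set as
    event for the other indices. *)
Lemma mutually_independentP {dO dT} {Omega : measurableType dO}
    {T : measurableType dT} (Pr : probability Omega R) m
    (X : 'I_m -> {RV Pr >-> T}) :
  mutually_independent X <->
  forall A : 'I_m -> set T, (forall i, measurable (A i)) ->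
    Pr (\bigcap_i (X i @^-1` A i)) = (\prod_i Pr (X i @^-1` A i))%E.
Proof.
split=> [indX A mA|indX J A mA].
  have := indX [set: 'I_m]%SET A mA.
  rewrite (eq_bigl predT)/= => [<-|i]; last by rewrite inE.
  by congr (Pr _); apply/seteqP; split=> w Aw i _; apply: Aw; rewrite /= ?inE.
pose B i := if i \in J then A i else setT.
have mB i : measurable (B i) by rewrite /B; case: ifP.
have := indX B mB.
rewrite [X in _ = X](_ : _ = \prod_(i in J) Pr (X i @^-1` A i))%E; last first.
  rewrite [RHS]big_mkcond; apply: eq_bigr => i _; rewrite /B; case: ifP => // _.
  by rewrite preimage_setT probability_setT.
move=> <-; congr (Pr _); apply/seteqP; split=> [w + i _|w + i].
  by rewrite /B => Aw; case: ifPn => // iJ; exact: Aw.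
by move=> /(_ i I); rewrite /B /= => + iJ; rewrite iJ.
Qed.

Lemma iid_reindex {dO dT} {Omega : measurableType dO}
    {T : measurableType dT} (Pr : probability Omega R) (P : probability T R)
    m k (X : 'I_m -> {RV Pr >-> T}) (s : 'I_k -> 'I_m) :
  injective s -> iid P X -> iid P (X \o s).
Proof.
move=> s_inj [lawX indX]; split=> [i|]; first exact: lawX.
apply/mutually_independentP => A mA.
pose B j := if [pick i | s i == j] is Some i then A i else setT.
have Bs i : B (s i) = A i.
  by rewrite /B; case: pickP => [j /eqP/s_inj->//|/(_ i)]; rewrite eqxx.
have mB j : measurable (B j) by rewrite /B; case: pickP.
have := indX (s @: 'I_k)%SET B mB.
rewrite big_imset/=; last by move=> i j _ _; exact: s_inj.
under eq_bigr do rewrite Bs.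
move=> <-; congr (Pr _); apply/seteqP; split=> [w Aw j /=|w Aw i _ /=].
  by move=> /imsetP[i _ ->]; rewrite /= Bs; exact: Aw.
by have := Aw (s i); rewrite /= Bs; apply; apply: imset_f.
Qed.

(** Enlarging the probability space by a measure-preserving map changes
    nothing. *)
Lemma iid_pullback {dO dO' dT} {Omega : measurableType dO}
    {Omega' : measurableType dO'} {T : measurableType dT}
    (Pr : probability Omega R) (Pr' : probability Omega' R)
    (P : probability T R) m (X : 'I_m -> {RV Pr >-> T})
    (phi : Omega' -> Omega) (X' : 'I_m -> {RV Pr' >-> T}) :
  (forall A, measurable A -> Pr' (phi @^-1` A) = Pr A) ->
  (forall i, X' i = X i \o phi :> (Omega' -> T)) ->
  iid P X -> iid P X'.
Proof.
move=> Pphi X'E [lawX indX].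
have PrX' i (A : set T) : measurable A -> Pr' (X' i @^-1` A) = Pr (X i @^-1` A).
  by move=> mA; rewrite X'E comp_preimage Pphi//; exact: measurable_funPTI.
split=> [i A mA|].
  by rewrite -(lawX i)// /distribution/= /pushforward PrX'.
apply/mutually_independentP => A mA.
under eq_bigr do rewrite PrX'//.
have /mutually_independentP <-// := indX.
rewrite -Pphi; last first.
  by apply: fin_bigcap_measurable => // i _; exact: measurable_funPTI.
by congr (Pr' _); apply/seteqP; split=> w Aw i _; have := Aw i I; rewrite /= X'E.
Qed.

Lemma iid_image {dO dT dT'} {Omega : measurableType dO}
    {T : measurableType dT} {T' : measurableType dT'}
    (Pr : probability Omega R) (P : probability T R) m
    (X : 'I_m -> {RV Pr >-> T}) (f : {RV P >-> T'})
    (X' : 'I_m -> {RV Pr >-> T'}) :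
  (forall i, X' i = f \o X i :> (Omega -> T')) ->
  iid P X -> iid (distribution P f) X'.
Proof.
move=> X'E [lawX indX]; split=> [i A mA|].
  rewrite /distribution/= /pushforward X'E comp_preimage.
  by apply: (lawX i); exact: measurable_funPTI.
apply/mutually_independentP => A mA.
under eq_bigr do rewrite X'E comp_preimage.
have /mutually_independentP <-// := indX; last first.
  by move=> i; exact: measurable_funPTI.
by congr (Pr _); apply/seteqP; split=> w Aw i _; have := Aw i I; rewrite /= X'E.
Qed.

(** By induction on the size: one more independent observation is a coordinate of
    a product space. *)
Lemma iid_exists {dT} {T : measurableType dT} (P : probability T R) m :
  exists (dO : measure_display) (Omega : measurableType dO)
    (Pr : probability Omega R) (X : 'I_m -> {RV Pr >-> T}), iid P X.
Proof.
elim: m => [|m IHm].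
  exists dT, T, P, (fun _ => rv P (@measurable_id _ T setT)).
  split; first by case.
  apply/mutually_independentP => A mA; rewrite big_ord0.
  rewrite [X in P X](_ : _ = setT) ?probability_setT//.
  by apply/seteqP; split=> // w _ [].
have [dO [Om [Pr [X iidX]]]] := IHm.
pose f i (w : T * Om) := if unlift ord0 i is Some j then X j w.2 else w.1.
have mf i : measurable_fun setT (f i).
  rewrite /f; case: unliftP => [j _|_]; last exact: measurable_fst.
  exact: measurableT_comp (measurable_funPT (X j)) measurable_snd.
have [lawX indX] := iidX.
have f0 A : f ord0 @^-1` A = A `*` setT.
  by apply/seteqP; split=> -[x w]; rewrite /f/= unlift_none//; case.
have fS j A : f (lift ord0 j) @^-1` A = setT `*` (X j @^-1` A).
  by apply/seteqP; split=> -[x w]; rewrite /f/= liftK//; case.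
have PrfS j A : measurable A ->
    (P \x Pr)%E (f (lift ord0 j) @^-1` A) = Pr (X j @^-1` A).
  move=> mA; rewrite fS product_measure1E//; last exact: measurable_funPTI.
  by rewrite [X in (X * _)%E](@probability_setT _ _ _ P) mul1e.
have Prf0 A : measurable A -> (P \x Pr)%E (f ord0 @^-1` A) = P A.
  move=> mA; rewrite f0 product_measure1E//.
  by rewrite [X in (_ * X)%E](@probability_setT _ _ _ Pr) mule1.
exists _, (T * Om)%type, (P \x Pr)%E, (fun i => rv (P \x Pr)%E (mf i)).
split=> [i A mA|].
  rewrite /distribution/= /pushforward/=.
  case: (unliftP ord0 i) => [j ->|->]; last exact: Prf0.
  by rewrite PrfS// -(lawX j).
apply/mutually_independentP => A mA.
rewrite big_ord_recl/= Prf0//.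
under eq_bigr do rewrite PrfS//.
have /mutually_independentP <-// := indX.
rewrite -product_measure1E//; last first.
  by apply: fin_bigcap_measurable => // i _; exact: measurable_funPTI.
congr ((P \x Pr)%E _); apply/seteqP; split=> [w Aw|w [A0 AS] i _ /=].
  split; first by have := Aw ord0 I; rewrite /= /f unlift_none.
  by move=> j _; have := Aw (lift ord0 j) I; rewrite /= /f liftK.
by rewrite /f; case: unliftP => [j ->|->] //; exact: (AS j I).
Qed.

Lemma measurable_tupleof {dO dT} {Omega : measurableType dO}
    {T : measurableType dT} m (X : 'I_m -> Omega -> T) :
  (forall i, measurable_fun setT (X i)) ->
  measurable_fun setT (fun w => [tuple X i w | i < m]).
Proof.
move=> mX; apply/measurable_fun_tnthP => i.
by rewrite (_ : _ \o _ = X i)//; apply/funext => w /=; rewrite tnth_mktuple.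
Qed.

(** A law on tuples is determined by its values on rectangles, which form a
    pi-system generating the product sigma-algebra. *)
Lemma iid_tuple_law {dO dO' dT} {Omega : measurableType dO}
    {Omega' : measurableType dO'} {T : measurableType dT}
    (Pr : probability Omega R) (Pr' : probability Omega' R)
    (P : probability T R) m
    (X : 'I_m -> {RV Pr >-> T}) (X' : 'I_m -> {RV Pr' >-> T}) :
  iid P X -> iid P X' ->
  forall A : set (m.-tuple T), measurable A ->
    Pr [set w | A [tuple X i w | i < m]] =
    Pr' [set w | A [tuple X' i w | i < m]].
Proof.
move=> [lawX indX] [lawX' indX'].
have mX : measurable_fun setT (fun w => [tuple X i w | i < m]).
  by apply: measurable_tupleof => i; exact: measurable_funPT.
have mX' : measurable_fun setT (fun w => [tuple X' i w | i < m]).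
  by apply: measurable_tupleof => i; exact: measurable_funPT.
pose G := [set B : set (m.-tuple T) | exists2 A : 'I_m -> set T,
  forall i, measurable (A i) & B = [set t | forall i, A i (tnth t i)]].
have mG B : G B -> measurable B.
  move=> [A mA ->].
  rewrite (_ : [set _ | _] = \bigcap_i ((fun t => tnth t i) @^-1` A i)); last first.
    by apply/seteqP; split=> t /= At i; [move=> _|]; apply: At.
  apply: fin_bigcap_measurable => // i _.
  by rewrite -[X in measurable X]setTI; exact: measurable_tnth.
move=> A mA.
change (distribution Pr (rv Pr mX) A = distribution Pr' (rv Pr' mX') A).
apply: (measure_unique G (fun=> setT)) mA => {A} //.
- apply/seteqP; split=> B; last first.
    by apply: smallest_sub; [exact: sigma_algebra_measurable|exact: mG].
  apply: smallest_sub; first exact: smallest_sigma_algebra.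
  move=> {}B; rewrite -bigcup_seq => -[i _ [A mA <-]].
  apply: sub_sigma_algebra; exists (fun j => if j == i then A else setT).
    by move=> j; case: ifP.
  rewrite setTI; apply/seteqP; split=> t /= At; last by have := At i; rewrite eqxx.
  by move=> j; case: eqP => // ->.
- move=> _ _ [A mA ->] [B mB ->]; exists (fun i => A i `&` B i).
    by move=> i; exact: measurableI.
  apply/seteqP; split=> t /=; first by move=> [At Bt] i; split.
  by move=> ABt; split=> i; have [] := ABt i.
- by move=> _; exists (fun=> setT) => //; apply/seteqP; split.
- by apply/seteqP; split=> // t _; exists 0.
- move=> _ [A mA ->]; rewrite /distribution/= /pushforward/=.
  transitivity (\prod_i P (A i))%E.
    rewrite -(eq_bigr _ (fun i _ => lawX i _ (mA i))).
    have /mutually_independentP <-// := indX.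
    by congr (Pr _); apply/seteqP; split=> w Aw i => [_|]; have := Aw i;
      rewrite /= tnth_mktuple //; apply.
  rewrite -(eq_bigr _ (fun i _ => lawX' i _ (mA i))).
  have /mutually_independentP <-// := indX'.
  by congr (Pr' _); apply/seteqP; split=> w Aw i => [|_]; have := Aw i;
    rewrite /= tnth_mktuple //; apply.
- by move=> _; apply: le_lt_trans (ltry 1); exact: probability_le1.
Qed.

End IID.

(** * Collisions in an independent sample *)

Section Collision.
Context {R : realType}.
Local Open Scope ereal_scope.

Lemma iid_tuple_integral {dO dO' dT} {Omega : measurableType dO}
    {Omega' : measurableType dO'} {T : measurableType dT}
    (Pr : probability Omega R) (Pr' : probability Omega' R)
    (P : probability T R) m
    (X : 'I_m -> {RV Pr >-> T}) (X' : 'I_m -> {RV Pr' >-> T})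
    (f : m.-tuple T -> \bar R) :
  iid P X -> iid P X' -> measurable_fun [set: m.-tuple T] f -> (forall t, 0 <= f t) ->
  \int[Pr]_w f [tuple X i w | i < m] = \int[Pr']_w f [tuple X' i w | i < m].
Proof.
move=> iidX iidX' mf f0.
have mX : measurable_fun setT (fun w => [tuple X i w | i < m]).
  by apply: measurable_tupleof => i; exact: measurable_funPT.
have mX' : measurable_fun setT (fun w => [tuple X' i w | i < m]).
  by apply: measurable_tupleof => i; exact: measurable_funPT.
transitivity (\int[distribution Pr (rv Pr mX)]_t f t).
  by rewrite ge0_integral_distribution.
transitivity (\int[distribution Pr' (rv Pr' mX')]_t f t); last first.
  by rewrite ge0_integral_distribution.
by apply: eq_measure_integral => A mA _; exact: (iid_tuple_law iidX iidX').
Qed.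

(** Two independent observations have the product law, so that Tonelli reduces a
    bound on a binary relation E to a uniform bound on its sections. *)
Lemma iid_pair_section {dO dT} {Omega : measurableType dO}
    {T : measurableType dT} (Pr : probability Omega R) (P : probability T R) m
    (X : 'I_m -> {RV Pr >-> T}) (E : set (T * T)) (c : \bar R) i j :
  iid P X -> i != j -> measurable E -> (forall x, P (xsection E x) <= c) ->
  Pr [set w | E (X i w, X j w)] <= c.
Proof.
move=> [lawX indX] ij mE Ec.
have mXX : measurable_fun setT (fun w => (X i w, X j w)).
  by apply: measurable_fun_pair; exact: measurable_funPT.
have <- : (P \x P) E = Pr [set w | E (X i w, X j w)].
  change ((P \x P) E = distribution Pr (rv Pr mXX) E).
  apply: product_measure_unique mE => A B mA mB.
  have := indX [set i; j]%SET (fun k => if k == i then A else B).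
  rewrite big_setU1/= ?inE// big_set1 eqxx eq_sym (negbTE ij).
  rewrite -(lawX i _ mA) -(lawX j _ mB) => <-; last by move=> k; case: ifP.
  congr (Pr _); apply/seteqP; split=> w /=.
    move=> [Aw Bw] k /=; rewrite !inE => /orP[]/eqP ->; first by rewrite eqxx.
    by rewrite eq_sym (negbTE ij).
  move=> ABw; split.
    by have := ABw i; rewrite /= eqxx !inE eqxx; exact.
  by have := ABw j; rewrite /= eq_sym (negbTE ij) !inE eqxx orbT; exact.
rewrite -[c]mule1 -(probability_setT P) -integral_cst//.
apply: ge0_le_integral => //.
- exact: measurable_fun_xsection.
- by move=> x _; apply: le_trans (Ec x).
Qed.

(** Union bound over the pairs of indices.  It is applied with c = 0 to the points
    of a sample from a nonatomic law, and with c = 1 / M to uniform indices. *)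
Lemma iid_collision {dO dT} {Omega : measurableType dO}
    {T : measurableType dT} (Pr : probability Omega R) (P : probability T R) m
    (X : 'I_m -> {RV Pr >-> T}) (E : set (T * T)) (c : R) :
  iid P X -> measurable E -> (forall x, P (xsection E x) <= c%:E) ->
  let coll := [set w | exists i j, i != j /\ E (X i w, X j w)] in
  measurable coll /\ Pr coll <= ((m * m)%:R * c)%:E.
Proof.
move=> iidX mE Ec coll.
pose A (p : 'I_m * 'I_m) := [set w | p.1 != p.2 /\ E (X p.1 w, X p.2 w)].
have collE : coll = \bigcup_(p in [set: 'I_m * 'I_m]) A p.
  apply/seteqP; split=> w; first by move=> [i [j [ij Ew]]]; exists (i, j).
  by move=> [[i j]/= _ [ij Ew]]; exists i, j.
have fin2 : finite_set [set: 'I_m * 'I_m] := finite_finset.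
have A0 p : p.1 = p.2 -> A p = set0.
  by move=> p12; apply/seteqP; split=> w // -[]; rewrite p12 eqxx.
have A1 p : p.1 != p.2 -> A p = [set w | E (X p.1 w, X p.2 w)].
  by move=> p12; apply/seteqP; split=> w // -[].
have mA p : measurable (A p).
  have [/A0 ->//|/A1 ->] := eqVneq p.1 p.2.
  rewrite -[X in measurable X]setTI; apply: (measurable_fun_pair
    (measurable_funPT (X p.1)) (measurable_funPT (X p.2))) mE => //.
have c0 : (0 <= c)%R by rewrite -lee_fin; exact: le_trans (Ec point).
have mcoll : measurable coll by rewrite collE; exact: fin_bigcup_measurable.
split=> //; apply: (@le_trans _ _ (\sum_(p \in [set: 'I_m * 'I_m]) Pr (A p))).
  by apply: content_sub_fsum => //; rewrite collE.
rewrite (fsbigE (enum {: 'I_m * 'I_m}))/= ?enum_uniq//; last first.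
  by move=> p _; rewrite mem_enum.
apply: (@le_trans _ _ (\sum_(p <- enum {: 'I_m * 'I_m}) c%:E)).
  rewrite big_mkcond; apply: lee_sum => p _; rewrite in_setT.
  have [/A0 ->|p12] := eqVneq p.1 p.2; first by rewrite measure0 lee_fin.
  by rewrite A1//; exact: (iid_pair_section iidX p12 mE).
by rewrite sumEFin lee_fin big_const_seq iter_addr_0 count_predT -cardE
  card_prod !card_ord mulr_natl.
Qed.

End Collision.

(** * Uniform indices *)

Section UniformIndex.
Context {R : realType}.
Variable m : nat.
Local Open Scope ereal_scope.

(** The uniform law on {0, ..., m}, as a law on the discrete space of natural
    numbers; a draw k designates the element [inord k] of a population of size
    m.+1. *)
Definition uniform_index : probability nat R :=
  mnormalize (msum (fun i => \d_i) m.+1) (\d_0%N : probability nat R).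

Lemma uniform_index_fiber (j : 'I_m.+1) :
  uniform_index (inord @^-1` [set j]) = (m.+1%:R^-1)%:E.
Proof.
have total : msum (fun i => \d_i : {measure set nat -> \bar R}) m.+1 [set: nat]
    = m.+1%:R%:E.
  rewrite /msum/=; under eq_bigr => i _ do rewrite diracT.
  by rewrite sumEFin sumr_const card_ord.
have normE (mu : {measure set nat -> \bar R}) (P : probability nat R) (A : set nat) :
    mu [set: nat] = m.+1%:R%:E -> mnormalize mu P A = mu A * (m.+1%:R^-1)%:E.
  by move=> muT; rewrite /mnormalize muT eqe pnatr_eq0.
rewrite [LHS](normE _ _ _ total) /= /msum.
rewrite (bigD1 j)//= diracE mem_set/= ?inord_val//.
rewrite big1 ?adde0 ?mul1e// => i ij; rewrite diracE memNset//=.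
by rewrite inord_val; exact/eqP.
Qed.

End UniformIndex.

(** * Points and labels *)

Section Points.
Context {R : realType}.
Variable d : nat.

Lemma measurable_point (x : d.-tuple R) : measurable [set x].
Proof.
rewrite (_ : [set x] = \bigcap_i ((fun t => tnth t i) @^-1` [set tnth x i])).
  apply: fin_bigcap_measurable => // i _.
  by rewrite -[X in measurable X]setTI; exact: measurable_tnth.
apply/seteqP; split=> t /=; first by move=> -> i.
by move=> H; apply: eq_from_tnth => i; exact: (H i I).
Qed.

Lemma measurable_same_point :
  measurable [set zz : obs R d * obs R d | zz.1.1 = zz.2.1].
Proof.
rewrite (_ : [set _ | _] = \bigcap_i
    [set zz | tnth zz.1.1 i == tnth zz.2.1 i]); last first.
  apply/seteqP; split=> zz /= zzE; first by move=> i _; rewrite /= zzE.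
  by apply: eq_from_tnth => i; apply/eqP; exact: zzE.
apply: fin_bigcap_measurable => // i _.
rewrite -[X in measurable X]setTI.
have mt (g : obs R d * obs R d -> obs R d) : measurable_fun setT g ->
    measurable_fun setT (fun zz => tnth (g zz).1 i).
  move=> mg; apply: (measurableT_comp (measurable_tnth i)).
  exact: (measurableT_comp measurable_fst mg).
exact: (measurable_fun_eqr (mt _ measurable_fst) (mt _ measurable_snd)
  measurableT (Y := [set true])).
Qed.

(** Nonatomicity is about pairs of a point and a label; as there are only two
    labels, it passes to the points. *)
Lemma nonatomic_same_point (P : probability (obs R d) R) (z : obs R d) :
  nonatomic P ->
  P (xsection [set zz : obs R d * obs R d | zz.1.1 = zz.2.1] z) = 0%E.
Proof.
move=> P0.
have mz (y : obs R d) : measurable [set y].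
  rewrite (_ : [set y] = [set y.1] `*` [set y.2]); last first.
    by case: y => a b; apply/seteqP; split=> -[a' b'] /= [-> ->].
  by apply: measurableX => //; exact: measurable_point.
rewrite (_ : xsection _ _ = [set (z.1, true)] `|` [set (z.1, false)]).
  by apply: null_set_setU; do ?[exact: mz|exact: P0].
apply/seteqP; split=> -[x y]; rewrite /xsection /= inE/=.
  by move=> <-; case: y; [left|right].
by case=> -[].
Qed.

(** When the label is a function of the point, the label probability takes only
    the values 0 and 1. *)
Lemma is_label_prob_indic {dO} {Omega : measurableType dO}
    (Pr : probability Omega R) (Z : {RV Pr >-> obs R d})
    (S : set (d.-tuple R)) :
  measurable S -> (forall w, S (Z w).1 <-> (Z w).2) ->
  is_label_prob (distribution Pr Z) \1_S.
Proof.
move=> mS SZ; split=> [||A mA].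
- exact: measurable_indic.
- by move=> x; rewrite indicE ler0n lern1 leq_b1.
have mAT : measurable (A `*` [set: bool]) by exact: measurableX.
rewrite (eq_integral (fun z => (\1_(S `*` [set: bool]) z)%:E)); last first.
  move=> z _; congr (_%:E); rewrite !indicE; congr (nat_of_bool _)%:R.
  by apply/idP/idP; rewrite !inE//= => -[].
rewrite integral_indic//; last exact: measurableX.
rewrite /distribution/= /pushforward; congr (Pr _).
by apply/seteqP; split=> w /= [] => [[? _] [? _]|? /SZ]; do ?split=> //; apply/SZ.
Qed.

End Points.

(** * Coverage of the label as an integral *)

Section Coverage.
Context {R : realType} {n d : nat} (C : algorithm R n d).
Local Open Scope ereal_scope.

Definition label_covered : set (n.+1.-tuple (obs R d) * seed C) :=
  [set q | label R (tnth q.1 ord_max).2 \in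
    conf_set [tuple tnth q.1 (widen_ord (leqnSn n) i) | i < n] q.2
      (tnth q.1 ord_max).1].

Lemma measurable_label_covered : measurable label_covered.
Proof.
have mt i : measurable_fun setT
    (fun q : n.+1.-tuple (obs R d) * seed C => tnth q.1 i).
  exact: measurableT_comp (measurable_tnth i) measurable_fst.
have mlabel : measurable_fun [set: bool] (label R) by [].
have mg : measurable_fun setT (fun q : n.+1.-tuple (obs R d) * seed C =>
    ([tuple tnth q.1 (widen_ord (leqnSn n) i) | i < n], q.2,
     (tnth q.1 ord_max).1, label R (tnth q.1 ord_max).2)).
  apply: measurable_fun_pair; last first.
    exact: measurableT_comp mlabel (measurableT_comp measurable_snd (mt _)).
  apply: measurable_fun_pair; last exact: measurableT_comp measurable_fst (mt _).
  apply: measurable_fun_pair; last exact: measurable_snd.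
  exact: measurable_tupleof.
by have := mg measurableT _ (measurable_conf_set C); rewrite setTI.
Qed.

(** Probability over the seed alone, for a fixed sample, that the label of the test
    point is covered. *)
Definition coverage (t : n.+1.-tuple (obs R d)) : \bar R :=
  seed_law C (xsection label_covered t).

Lemma measurable_coverage : measurable_fun [set: n.+1.-tuple (obs R d)] coverage.
Proof. exact: measurable_fun_xsection measurable_label_covered. Qed.

Lemma coverage_ge0 t : 0 <= coverage t.
Proof. exact: measure_ge0. Qed.

Lemma coverage_le1 t : coverage t <= 1.
Proof.
by apply: probability_le1; apply: measurable_xsection; exact: measurable_label_covered.
Qed.

(** The joint law of the sample and the seed is a product, because they are
    independent. *)
Lemma coverageE {dO} {Omega : measurableType dO} (Pr : probability Omega R)
    (Z : 'I_n.+1 -> {RV Pr >-> obs R d}) (U : {RV Pr >-> seed C})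
    (P : probability (obs R d) R) :
  experiment Z U P ->
  Pr [set w | label R (test_y Z w) \in random_conf_set Z U w] =
  \int[Pr]_w coverage [tuple Z i w | i < n.+1].
Proof.
move=> [iidZ lawU indU].
have mZ : measurable_fun setT (fun w => [tuple Z i w | i < n.+1]).
  by apply: measurable_tupleof => i; exact: measurable_funPT.
have mZU : measurable_fun setT (fun w => ([tuple Z i w | i < n.+1], U w)).
  by apply: measurable_fun_pair => //; exact: measurable_funPT.
transitivity (distribution Pr (rv Pr mZU) label_covered).
  have trainE w : [tuple tnth [tuple Z i w | i < n.+1] (widen_ord (leqnSn n) i) | i < n]
      = [tuple Z (widen_ord (leqnSn n) i) w | i < n].
    by apply: eq_from_tnth => i; rewrite !tnth_mktuple.
  congr (Pr _); apply/seteqP; split=> w;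
    by rewrite /= /label_covered /= trainE tnth_mktuple.
have <- : (distribution Pr (rv Pr mZ) \x seed_law C) label_covered =
    distribution Pr (rv Pr mZU) label_covered.
  apply: product_measure_unique measurable_label_covered => A B mA mB.
  by rewrite -[X in _ = _ * X](lawU B mB); exact: (indU A B mA mB).
exact: (ge0_integral_distribution (rv Pr mZ) measurable_coverage coverage_ge0).
Qed.

End Coverage.

(** * Resampling from a finite population *)

Section Resampling.
Context {R : realType} {n d : nat} (alpha : R) (C : algorithm R n d).
Hypothesis C_CI : distribution_free_CI alpha C.
Local Open Scope ereal_scope.

(** Coverage under the empirical distribution Q of the population L.  The label
    probability of Q is the indicator of the set S of the points labelled 1; since
    the points of L are distinct, it agrees with the label on all of L, hence
    covering the label probability is covering the label. *)
Lemma resample_coverage m (L : 'I_m.+1 -> obs R d)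
    {dI} {OmegaI : measurableType dI} (PrI : probability OmegaI R)
    (I_ : 'I_n.+1 -> {RV PrI >-> nat}) :
  iid (@uniform_index R m) I_ -> injective (fun i => (L i).1) ->
  (1 - alpha)%:E <= \int[PrI]_v coverage C [tuple L (inord (I_ k v)) | k < n.+1].
Proof.
move=> iidI L_inj.
have mf : measurable_fun [set: nat] (fun k : nat => L (inord k)) by [].
pose Q := distribution (@uniform_index R m) (rv (@uniform_index R m) mf).
pose S := [set x | exists2 j, (L j).1 = x & (L j).2].
have mS : measurable S.
  rewrite (_ : S = \bigcup_j (if (L j).2 then [set (L j).1] else set0)).
    apply: fin_bigcup_measurable; first exact: finite_finset.
    by move=> j _; case: ifP => // _; exact: measurable_point.
  apply/seteqP; split=> x; first by move=> [j <- Lj]; exists j => //; rewrite Lj.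
  by move=> [j _]; case: ifP => // Lj ->; exists j.
have SL j : S (L j).1 <-> (L j).2.
  by split=> [[i /L_inj -> //]|Lj]; exists j.
have labelQ : is_label_prob Q \1_S by apply: is_label_prob_indic => // k; exact: SL.
pose Pr' := (PrI \x seed_law C)%E.
have mI k : measurable_fun setT (fun v => L (inord (I_ k v))).
  exact: measurableT_comp mf (measurable_funPT (I_ k)).
have mI' k : measurable_fun setT (fun v : OmegaI * seed C => L (inord (I_ k v.1))).
  exact: measurableT_comp (mI k) measurable_fst.
pose ZI k := rv PrI (mI k); pose Z k := rv Pr' (mI' k).
pose U := rv Pr' (@measurable_snd _ _ OmegaI (seed C)).
have iidZI : iid Q ZI by apply: iid_image iidI.
have Pr'X (A : set OmegaI) (B : set (seed C)) : measurable A -> measurable B ->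
    Pr' (A `*` B) = PrI A * seed_law C B by exact: product_measure1E.
have Pr'1 (A : set OmegaI) : measurable A -> Pr' (fst @^-1` A) = PrI A.
  move=> mA; rewrite (_ : fst @^-1` A = A `*` setT).
    by rewrite Pr'X// [X in _ * X](@probability_setT _ _ _ (seed_law C)) mule1.
  by apply/seteqP; split=> -[v u]//= [].
have Pr'2 (B : set (seed C)) : measurable B -> Pr' (snd @^-1` B) = seed_law C B.
  move=> mB; rewrite (_ : snd @^-1` B = setT `*` B).
    by rewrite Pr'X// [X in X * _](@probability_setT _ _ _ PrI) mul1e.
  by apply/seteqP; split=> -[v u]//= [].
have iidZ : iid Q Z by exact: iid_pullback Pr'1 _ iidZI.
have expZ : experiment Z U Q.
  split; [exact: iidZ|by move=> B mB; rewrite -(Pr'2 B mB)|].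
  move=> A B mA mB.
  have mA' : measurable [set v | A [tuple ZI k v | k < n.+1]].
    rewrite -[X in measurable X]setTI.
    exact: (measurable_tupleof mI measurableT mA).
  by have := Pr'X _ _ mA' mB; rewrite -(Pr'1 _ mA') -(Pr'2 _ mB).
have := C_CI labelQ expZ.
have -> : [set w | \1_S (test_x Z w) \in random_conf_set Z U w] =
    [set w | label R (test_y Z w) \in random_conf_set Z U w].
  suff SE w : \1_S (test_x Z w) = label R (test_y Z w).
    by apply/seteqP; split=> w /=; rewrite SE.
  rewrite indicE /label; congr (nat_of_bool _)%:R.
  by apply/idP/idP => [/set_mem/SL|/SL/mem_set].
rewrite (coverageE expZ) => /le_trans; apply.
by rewrite (iid_tuple_integral iidZ iidZI (measurable_coverage C) (coverage_ge0 C)).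
Qed.

(** Both bounds are for the integral of [F], the coverage of the subsample with
    indices J of the population X.  Integrating over J first, for a fixed
    population, gives a lower bound; integrating over X first, for fixed indices,
    gives an upper bound. *)
Lemma predictive_coverage_approx (P : probability (obs R d) R) m
    {dO} {Omega : measurableType dO} (Pr : probability Omega R)
    (Z : 'I_n.+1 -> {RV Pr >-> obs R d}) :
  (alpha <= 1)%R -> nonatomic P -> iid P Z ->
  (1 - alpha)%:E <= \int[Pr]_w coverage C [tuple Z i w | i < n.+1] +
                    ((n.+1 * n.+1)%:R * m.+1%:R^-1)%:E.
Proof.
move=> alpha1 P0 iidZ.
have [dL [OL [PrL [X iidX]]]] := iid_exists P m.+1.
have [dI [OI [PrI [J iidJ]]]] := iid_exists (@uniform_index R m) n.+1.
pose F (v : OL * OI) := coverage C [tuple X (inord (J k v.2)) v.1 | k < n.+1].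
have mF : measurable_fun setT F.
  apply: measurableT_comp (measurable_coverage C) _.
  apply: measurable_tupleof => k.
  (* measurability in the index is free, as nat is countable and discrete *)
  have mXJ : measurable_fun setT (fun v : OL * nat => X (inord v.2) v.1).
    move=> _ A mA; rewrite setTI.
    rewrite (_ : _ @^-1` A = \bigcup_i ((X (inord i) @^-1` A) `*` [set i])).
      apply: bigcupT_measurable => i; apply: measurableX => //.
      exact: measurable_funPTI.
    apply/seteqP; split=> -[w i] /=; first by move=> Aw; exists i.
    by move=> [j _ [/= Aw ->]].
  have mJ : measurable_fun setT (fun v : OL * OI => (v.1, J k v.2)).
    apply: measurable_fun_pair; first exact: measurable_fst.
    exact: measurableT_comp (measurable_funPT (J k)) measurable_snd.
  exact: measurableT_comp mXJ mJ.
have F0 v : 0 <= F v by exact: coverage_ge0.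
pose q := \int[Pr]_w coverage C [tuple Z i w | i < n.+1]; rewrite -/q.
have q0 : 0 <= q by apply: integral_ge0 => w _; exact: coverage_ge0.
(* the points of X are almost surely distinct, as required to resample from X *)
have lower : (1 - alpha)%:E <= \int[PrL]_w \int[PrI]_v F (w, v).
  have /= [|mcoll] := iid_collision (c := 0) iidX (@measurable_same_point R d).
    by move=> z; rewrite nonatomic_same_point.
  set coll := (X in PrL X) in mcoll *; rewrite mulr0 => coll0.
  rewrite -[(1 - alpha)%:E]mule1 -(probability_setT PrL) -integral_cst//.
  apply: ae_ge0_le_integral => //.
  - by move=> w _; rewrite lee_fin subr_ge0.
  - by move=> w _; exact: integral_ge0.
  - exact: (measurable_fun_fubini_tonelli_F F mF F0).
  exists coll; split=> //.
    by apply/eqP; rewrite eq_le coll0 measure_ge0.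
  move=> w /= H; apply: contrapT => ncoll; apply: H => _.
  apply: (resample_coverage (L := fun i => X i w) iidJ) => i j ij; apply/eqP/negPn/negP => nij.
  by apply: ncoll; exists i, j.
have /= [||mcoll] := iid_collision (c := m.+1%:R^-1)
  (E := [set jk : nat * nat | @inord m jk.1 = @inord m jk.2]) iidJ.
- rewrite (_ : [set _ | _] = \bigcup_i ((@inord m @^-1` [set i]) `*` (@inord m @^-1` [set i]))).
    by apply: fin_bigcup_measurable; [exact: finite_finset|move=> i _; exact: measurableX].
  apply/seteqP; split=> -[j k]/=; first by move=> jk; exists (inord j).
  by move=> [i _ [/= ji ki]]; rewrite ji ki.
- move=> j; rewrite -(uniform_index_fiber (inord j)) le_eqVlt; apply/orP; left.
  by apply/eqP; congr (_ _); apply/seteqP; split=> k; rewrite /xsection/= ?inE.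
set coll := (X in PrI X) in mcoll * => collE.
apply: (le_trans lower); rewrite (fubini_tonelli F mF F0).
(* distinct indices select an iid subfamily of X; the coverage is otherwise at
   most 1 *)
have inner v : \int[PrL]_w F (w, v) <= q + (\1_coll v)%:E.
  have [vcoll|nvcoll] := pselect (coll v).
    rewrite indicE mem_set// -[leLHS]add0e; apply: leeD => //.
    rewrite -(probability_setT PrL) -[leRHS]mul1e -integral_cst//.
    apply: ge0_le_integral => //.
    - exact: measurableT_comp mF (pair2_measurable _).
    - by move=> w _; exact: coverage_le1.
  rewrite indicE memNset// adde0 /q /F/=.
  have s_inj : injective (fun k => @inord m (J k v)).
    move=> i j ij; apply/eqP/negPn/negP => nij.
    by apply: nvcoll; exists i, j.
  rewrite (iid_tuple_integral iidZ (iid_reindex s_inj iidX)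
    (measurable_coverage C) (coverage_ge0 C)).
  by [].
apply: (@le_trans _ _ (\int[PrI]_v (q + (\1_coll v)%:E))).
  apply: ge0_le_integral => //.
  - by move=> v _; exact: integral_ge0.
  - exact: (measurable_fun_fubini_tonelli_G F mF F0).
  - by apply: emeasurable_funD => //; apply/measurable_EFinP; exact: measurable_indic.
rewrite ge0_integralD//; last by apply/measurable_EFinP; exact: measurable_indic.
rewrite integral_cst// [X in q * X]probability_setT mule1 integral_indic// setIT.
exact: leeD.
Qed.

End Resampling.

Unset Implicit Arguments.

Theorem theorem1 (R : realType) (n d : nat) (hn : (1 <= n)%N) (hd : (1 <= d)%N)
    (alpha : R) (halpha : 0 <= alpha <= 1) (C : algorithm R n d)
    (hC : distribution_free_CI alpha C)
    (P : probability (obs R d) R) (hP : nonatomic P) :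
  predictive_coverage alpha C P.
Proof.
move=> dO Omega Pr Z U expZ; have [iidZ _ _] := expZ.
rewrite (coverageE expZ); apply/lee_addgt0Pr => e e0.
have /andP[_ alpha1] := halpha.
(* a population size above (n + 1)^2 / e *)
pose m := Num.truncn ((n.+1 * n.+1)%:R / e).
apply: le_trans (predictive_coverage_approx hC m alpha1 hP iidZ) _.
apply: leeD => //; rewrite lee_fin ler_pdivrMr// mulrC -ler_pdivrMr//.
exact/ltW/truncnS_gt.
Qed.
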